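(* Let $C \subseteq \mathbb{R}^n$ be a nonempty closed convex set. The following are equivalent: (i) $C$ is approximately M-decomposable; (ii) $\operatorname{dom}\sigma_C$ is closed and $\sigma_C$ is continuous relative to $\operatorname{dom}\sigma_C$ (i.e. the restriction $\sigma_C \colon \operatorname{dom}\sigma_C \to \mathbb{R}$ is continuous). Moreover, when (ii) holds, the set $\operatorname{dom}\sigma_C$ equals $(0^{+}C)^{\circ}$.
   Context: $B$ denotes the closed Euclidean unit ball of $\mathbb{R}^n$, $\|\cdot\|$ the Euclidean norm, and $M+P$ the Minkowski sum of sets. For a nonempty closed convex set $C \subseteq \mathbb{R}^n$: - the recession cone is $0^{+}C = \{d \in \mathbb{R}^n : x + \mu d \in C \text{ for all } x \in C,\ \mu \geq 0\}$; - the support function is $\sigma_C(d) = \sup\{d^{\mathsf T}x : x \in C\}$, with values in $\mathbb{R}\cup\{+\infty\}$, and its domain is $\operatorname{dom}\sigma_C = \{d \in \mathbb{R}^n : \sigma_C(d) < +\infty\}$; - for $r > 0$ the truncation of $C$ of radius $r$ is $C_r = (C \cap rB) + 0^{+}C$ (empty if $C \cap rB$ is empty); - $C$ is called approximately M-decomposable if for every $\varepsilon > 0$ there exists $r > 0$ such that $C \subseteq C_r + \varepsilon B$. For a cone $K \subseteq \mathbb{R}^n$ the polar is $K^{\circ} = \{y \in \mathbb{R}^n : y^{\mathsf T}x \leq 0 \text{ for all } x \in K\}$. *)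

(* Defs.v *)
From HB Require Import structures.
From mathcomp Require Import all_boot all_order all_algebra.
From mathcomp Require Import all_classical all_reals all_analysis.

Set Implicit Arguments.
Unset Strict Implicit.
Unset Printing Implicit Defensive.

Import Order.TTheory GRing.Theory Num.Theory.
Import numFieldNormedType.Exports.

Local Open Scope classical_set_scope.
Local Open Scope ring_scope.

(* R^n is 'cV[R]_n, any n : nat. The library norm `|x| on matrices is the sup
   norm, hence the separate Euclidean norm below. The library topology on
   'cV[R]_n (used for closed sets and continuity) is the entrywise one, which
   is the usual topology of R^n. *)

Definition dotv (R : realType) (n : nat) (x y : 'cV[R]_n) : R :=
  (x^T *m y) ord0 ord0.

Definition enorm (R : realType) (n : nat) (x : 'cV[R]_n) : R :=
  Num.sqrt (dotv x x).

Definition unit_ball (R : realType) (n : nat) : set 'cV[R]_n :=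
  [set x | enorm x <= 1].

Definition minkowski_sum (R : realType) (n : nat) (M P : set 'cV[R]_n) :
    set 'cV[R]_n :=
  [set x + y | x in M & y in P].

Definition scale_set (R : realType) (n : nat) (r : R) (M : set 'cV[R]_n) :
    set 'cV[R]_n :=
  [set r *: x | x in M].

Definition recession_cone (R : realType) (n : nat) (C : set 'cV[R]_n) :
    set 'cV[R]_n :=
  [set d | forall (x : 'cV[R]_n) (mu : R), C x -> 0 <= mu -> C (x + mu *: d)].

Definition support_fun (R : realType) (n : nat) (C : set 'cV[R]_n)
    (d : 'cV[R]_n) : \bar R :=
  ereal_sup [set (dotv d x)%:E | x in C].

Definition support_dom (R : realType) (n : nat) (C : set 'cV[R]_n) :
    set 'cV[R]_n :=
  [set d | (support_fun C d < +oo)%E].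

(* Real-valued version of the support function: for C nonempty it agrees with
   support_fun on support_dom; outside that domain its value (0) is junk. *)
Definition support_funR (R : realType) (n : nat) (C : set 'cV[R]_n)
    (d : 'cV[R]_n) : R :=
  fine (support_fun C d).

Definition truncation (R : realType) (n : nat) (C : set 'cV[R]_n) (r : R) :
    set 'cV[R]_n :=
  minkowski_sum (C `&` scale_set r (@unit_ball R n)) (recession_cone C).

Definition approx_M_decomposable (R : realType) (n : nat)
    (C : set 'cV[R]_n) : Prop :=
  forall eps : R, 0 < eps -> exists2 r : R, 0 < r &
    C `<=` minkowski_sum (truncation C r) (scale_set eps (@unit_ball R n)).

Definition polar (R : realType) (n : nat) (K : set 'cV[R]_n) :
    set 'cV[R]_n :=
  [set y | forall x : 'cV[R]_n, K x -> dotv y x <= 0].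

(* Main.v *)
Require Import Defs.
From HB Require Import structures.
From mathcomp Require Import all_boot all_order all_algebra.
From mathcomp Require Import all_classical all_reals all_analysis.
From mathcomp Require Import ring lra.

Import Order.TTheory GRing.Theory Num.Theory.
Import numFieldNormedType.Exports.

Local Open Scope classical_set_scope.
Local Open Scope ring_scope.

(* The domain of [sigma_C] is a convex cone contained in the polar of [0^+ C], and
   separation shows that it is dense there; if closed, it is the whole polar.

   (i) -> (ii): [C `<=` C_r + eps B] yields, for [d] and [d'] in the polar,
   [sigma_C d <= sigma_C d' + r |d - d'| + eps |d|], hence finiteness and
   continuity.

   (ii) -> (i): the support functions of the intersections of [C] with [r B]
   increase to [sigma_C], so by Dini they converge uniformly on the unit vectors
   of the domain. A point of [C] at distance at least [eps] from [C_r] is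
   separated from [C_r] by a gap [eps] along a unit vector of the domain, which
   contradicts this for large [r]. *)

Set Implicit Arguments.
Unset Strict Implicit.

(** * Euclidean inner product and norm *)

Lemma dotvE (R : realType) (n : nat) (x y : 'cV[R]_n) :
  dotv x y = \sum_i x i ord0 * y i ord0.
Proof. by rewrite /dotv mxE; apply: eq_bigr => i _; rewrite mxE. Qed.

Lemma dotvC (R : realType) (n : nat) (x y : 'cV[R]_n) : dotv x y = dotv y x.
Proof. by rewrite !dotvE; apply: eq_bigr => i _; rewrite mulrC. Qed.

Lemma dotvDr (R : realType) (n : nat) (x y z : 'cV[R]_n) :
  dotv x (y + z) = dotv x y + dotv x z.
Proof. by rewrite /dotv mulmxDr mxE. Qed.

Lemma dotvZr (R : realType) (n : nat) (a : R) (x y : 'cV[R]_n) :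
  dotv x (a *: y) = a * dotv x y.
Proof. by rewrite /dotv -scalemxAr mxE. Qed.

Lemma dotvDl (R : realType) (n : nat) (x y z : 'cV[R]_n) :
  dotv (x + y) z = dotv x z + dotv y z.
Proof. by rewrite dotvC dotvDr !(dotvC z). Qed.

Lemma dotvZl (R : realType) (n : nat) (a : R) (x y : 'cV[R]_n) :
  dotv (a *: x) y = a * dotv x y.
Proof. by rewrite dotvC dotvZr dotvC. Qed.

Lemma dotvNr (R : realType) (n : nat) (x y : 'cV[R]_n) :
  dotv x (- y) = - dotv x y.
Proof. by rewrite -scaleN1r dotvZr mulN1r. Qed.

Lemma dotvNl (R : realType) (n : nat) (x y : 'cV[R]_n) :
  dotv (- x) y = - dotv x y.
Proof. by rewrite dotvC dotvNr dotvC. Qed.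

Lemma dotv0r (R : realType) (n : nat) (x : 'cV[R]_n) : dotv x 0 = 0.
Proof. by rewrite -(scale0r 0) dotvZr mul0r. Qed.

Lemma dotv0l (R : realType) (n : nat) (x : 'cV[R]_n) : dotv 0 x = 0.
Proof. by rewrite dotvC dotv0r. Qed.

Definition dotv_lin := (dotvDl, dotvDr, dotvNl, dotvNr, dotvZl, dotvZr).

Lemma dotv_ge0 (R : realType) (n : nat) (x : 'cV[R]_n) : 0 <= dotv x x.
Proof. by rewrite dotvE sumr_ge0// => i _; rewrite -expr2 sqr_ge0. Qed.

Lemma enorm_ge0 (R : realType) (n : nat) (x : 'cV[R]_n) : 0 <= enorm x.
Proof. exact: sqrtr_ge0. Qed.

Lemma sqr_enorm (R : realType) (n : nat) (x : 'cV[R]_n) :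
  enorm x ^+ 2 = dotv x x.
Proof. by rewrite sqr_sqrtr// dotv_ge0. Qed.

Lemma enormZ (R : realType) (n : nat) (a : R) (x : 'cV[R]_n) :
  enorm (a *: x) = `|a| * enorm x.
Proof.
by rewrite /enorm dotvZl dotvZr mulrA -expr2 sqrtrM ?sqr_ge0// sqrtr_sqr.
Qed.

Lemma enormN (R : realType) (n : nat) (x : 'cV[R]_n) : enorm (- x) = enorm x.
Proof. by rewrite -scaleN1r enormZ normrN1 mul1r. Qed.

Lemma coord_le_enorm (R : realType) (n : nat) (x : 'cV[R]_n) i j :
  `|x i j| <= enorm x.
Proof.
rewrite (ord1 j) -(@ler_pXn2r _ 2) ?nnegrE ?enorm_ge0// sqr_enorm dotvE.
rewrite (bigD1 i)//= real_normK ?num_real// expr2 lerDl sumr_ge0// => k _.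
by rewrite -expr2 sqr_ge0.
Qed.

Lemma norm_le_enorm (R : realType) (n : nat) (x : 'cV[R]_n) :
  `|x| <= enorm x.
Proof.
rewrite [leLHS]/Num.norm/= mx_normrE; apply/bigmax_leP => /=.
by split=> [|[i j] _ /=]; [exact: enorm_ge0|exact: coord_le_enorm].
Qed.

Lemma enorm0_eq0 (R : realType) (n : nat) (x : 'cV[R]_n) :
  enorm x = 0 -> x = 0.
Proof.
by move=> x0; apply/normr0_eq0/le_anti; rewrite normr_ge0 -x0 norm_le_enorm.
Qed.

Lemma CauchySchwarz_dotv (R : realType) (n : nat) (x y : 'cV[R]_n) :
  dotv x y <= enorm x * enorm y.
Proof.
have [/enorm0_eq0 ->|x0] := eqVneq (enorm x) 0.
  by rewrite dotv0l mulr_ge0 ?enorm_ge0.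
have [/enorm0_eq0 ->|y0] := eqVneq (enorm y) 0.
  by rewrite dotv0r mulr_ge0 ?enorm_ge0.
have xy0 : 0 < enorm x * enorm y.
  by rewrite mulr_gt0// lt_neqAle eq_sym ?x0 ?y0 enorm_ge0.
(* This square equals [2 |x| |y| (|x| |y| - <x, y>)], and the factor [2 |x| |y|] is positive. *)
have := dotv_ge0 (enorm y *: x - enorm x *: y).
rewrite !dotv_lin (dotvC y x) -!sqr_enorm => h.
rewrite -subr_ge0 -(pmulr_rge0 _ xy0) -(pmulr_rge0 _ (ltr0n _ 2)).
by move: h; congr (_ <= _); ring.
Qed.

Lemma enormD (R : realType) (n : nat) (x y : 'cV[R]_n) :
  enorm (x + y) <= enorm x + enorm y.
Proof.
rewrite -(@ler_pXn2r _ 2) ?nnegrE ?addr_ge0 ?enorm_ge0//.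
rewrite sqr_enorm !dotv_lin (dotvC y) sqrrD !sqr_enorm.
by have := CauchySchwarz_dotv x y; lra.
Qed.

(** * Continuity, compactness and distance to closed sets *)

Lemma continuous_sum (R : realType) (T : topologicalType) (I : Type)
    (s : seq I) (F : I -> T -> R) :
  (forall i, continuous (F i)) -> continuous (fun x => \sum_(i <- s) F i x).
Proof.
move=> Fc; elim: s => [|i s IH] x.
  have -> : (fun x => \sum_(i <- [::]) F i x) = cst 0.
    by apply/funext => y; rewrite big_nil.
  exact: cst_continuous.
have -> : (fun x => \sum_(i <- i :: s) F i x)
    = (fun x => F i x + \sum_(i <- s) F i x).
  by apply/funext => y; rewrite big_cons.
exact: (cvgD (Fc i x) (IH x)).
Qed.

Lemma dotv_continuous (R : realType) (n : nat) (c : 'cV[R]_n) :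
  continuous (dotv c).
Proof.
rewrite (_ : dotv c = fun x => \sum_i c i ord0 * x i ord0); last first.
  by apply/funext => x; rewrite dotvE.
apply: continuous_sum => i x.
exact: (cvgM (cvg_cst _) (@coord_continuous _ _ _ i ord0 x)).
Qed.

Lemma enorm_continuous (R : realType) (n : nat) :
  continuous (@enorm R n).
Proof.
move=> x; apply: continuous_comp; last exact: sqrt_continuous.
rewrite (_ : (fun x => _) = fun x : 'cV[R]_n => \sum_i x i ord0 * x i ord0).
  apply: continuous_sum => i y.
  have yc := @coord_continuous _ _ _ i ord0 y.
  exact: (cvgM yc yc).
by apply/funext => y; rewrite dotvE.
Qed.

Lemma enormB_continuous (R : realType) (n : nat) (c : 'cV[R]_n) :
  continuous (fun x : 'cV[R]_n => enorm (c - x)).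
Proof.
move=> x; apply: continuous_comp; last exact: enorm_continuous.
exact: (cvgB (cvg_cst _) cvg_id).
Qed.

(** Heine-Borel is applied to row vectors; the set is carried there and back by transposition, which
    is continuous. *)
Lemma enorm_bounded_closed_compact (R : realType) (n : nat) (r : R)
    (A : set 'cV[R]_n) :
  closed A -> (forall x, A x -> enorm x <= r) -> compact A.
Proof.
move=> Acl Ar.
have trc p q : continuous (fun x : 'M[R]_(p, q) => x^T).
  move=> x B /= /nbhs_ballP[e e0 eB]; apply/nbhs_ballP; exists e => //.
  move=> y [_ xy]; apply: eB; split=> // i j.
  by rewrite !mxE; exact: xy.
have -> : A = (fun x : 'rV[R]_n => x^T) @` ((fun x : 'rV[R]_n => x^T) @^-1` A).
  apply/seteqP; split=> [x Ax|x [y Ay <-]//].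
  by exists x^T; rewrite /= ?trmxK.
apply: continuous_compact; first exact/continuous_subspaceT/trc.
apply: bounded_closed_compact; last first.
  by apply: preimage_closed => // x _; exact: trc.
exists r; split; first exact: num_real.
move=> M rM x /= Ax; rewrite [leLHS]/Num.norm/= mx_normrE.
apply/bigmax_leP => /=; split=> [|[i j] _ /=].
  by rewrite (le_trans _ (ltW rM))// (le_trans _ (Ar _ Ax))// enorm_ge0.
rewrite (le_trans _ (ltW rM))// (le_trans _ (Ar _ Ax))//.
by have := coord_le_enorm x^T j i; rewrite mxE.
Qed.

(** The open complement contains a sup-norm ball around [x], and [enorm] dominates the sup norm. *)
Lemma closed_enorm_dist (R : realType) (n : nat) (A : set 'cV[R]_n) x :
  closed A -> ~ A x -> exists2 e, 0 < e & forall y, A y -> e <= enorm (x - y).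
Proof.
move=> Acl nAx; have : nbhs x (~` A).
  by apply: open_nbhs_nbhs; split=> //; exact: closed_openC.
move=> /nbhs_normP[e e0 xeA]; exists e => // y Ay.
rewrite leNgt; apply/negP => xye; apply: (xeA y) => //.
by rewrite /= (le_lt_trans (norm_le_enorm _)).
Qed.

(** * Convex sets and separation *)

Lemma convex_setP (R : realType) (n : nat) (A : set 'cV[R]_n) :
  @convex_set R 'cV[R]_n A <->
  forall x y (t : R), 0 <= t <= 1 -> A x -> A y -> A (t *: x + (1 - t) *: y).
Proof.
split=> [cA x y t t01 Ax Ay|cA x y t /set_mem Ax /set_mem Ay].
  have tP : Itv.spec (Itv.num_sem (R:=R)) (Itv.Real `[0%Z, 1%Z]) t.
    by apply/and3P; split; rewrite ?num_real//; case/andP: t01.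
  exact: (set_mem (cA x y (Itv.mk tP) (mem_set Ax) (mem_set Ay))).
by apply/mem_set; apply: cA => //; rewrite ge0 le1.
Qed.

(** Grouped so that a factor [t] can be cancelled when perturbing a nearest point in
    [convex_separation]. *)
Lemma sqr_enormBZ (R : realType) (n : nat) (x y : 'cV[R]_n) (t : R) :
  enorm (x - t *: y) ^+ 2
  = enorm x ^+ 2 - t * (dotv x y *+ 2) + t * (t * enorm y ^+ 2).
Proof. by rewrite !sqr_enorm !dotv_lin (dotvC y); ring. Qed.

Lemma closure_sub_preimage (T U : topologicalType) (f : T -> U) (A : set T)
    (B : set U) :
  continuous f -> closed B -> A `<=` f @^-1` B -> closure A `<=` f @^-1` B.
Proof.
move=> fc Bcl /closure_subset AB.
by move/continuous_closedP : fc => /(_ _ Bcl)/closure_id ->.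
Qed.

Lemma closed_ge_preimage (R : realType) (T : topologicalType) (f : T -> R) r :
  continuous f -> closed [set x | r <= f x].
Proof. by move=> /continuous_closedP/(_ _ (@closed_ge R r)). Qed.

Lemma closed_le_preimage (R : realType) (T : topologicalType) (f : T -> R) r :
  continuous f -> closed [set x | f x <= r].
Proof. by move=> /continuous_closedP/(_ _ (@closed_le R r)). Qed.

(* The separating direction is [d = x - p] with [p] the point of the closure of
   [A] nearest to [x]. *)
Lemma convex_separation (R : realType) (n : nat) (A : set 'cV[R]_n) x (e : R) :
  A !=set0 -> @convex_set R 'cV[R]_n A ->
  (forall y, A y -> e <= enorm (x - y)) ->
  exists2 d, e <= enorm d &
    forall y, A y -> dotv d y + enorm d ^+ 2 <= dotv d x.
Proof.
move=> [a Aa] /convex_setP cA eA.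
have dc := @enormB_continuous R n x.
(* The closure of [A] may be unbounded. Cutting it by the ball around [x] through [a] makes it
   compact, and a point nearest to [x] there is nearest in the whole closure. *)
pose B := closure A `&` [set y | enorm (x - y) <= enorm (x - a)].
have Bcpt : compact B.
  apply: (@enorm_bounded_closed_compact _ _ (enorm (x - a) + enorm x)).
    by apply: closedI; [exact: closed_closure|exact: closed_le_preimage].
  move=> y [_ /= xya]; rewrite -enormN -[- y]add0r -(subrr x) addrAC.
  by rewrite (le_trans (enormD _ _))// (enormN x) lerD2r.
have Ba : B a by split=> /=; [exact: subset_closure|exact: lexx].
have [p /set_mem[Ap _] pmin] := compact_EVT_min (ex_intro _ a Ba) Bcpt
  (continuous_subspaceT dc).
have {}pmin y : closure A y -> enorm (x - p) <= enorm (x - y).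
  move=> Ay; have [ya|/ltW ay] := leP (enorm (x - y)) (enorm (x - a)).
    by apply: pmin; apply/mem_set.
  by rewrite (le_trans _ ay)// pmin//; apply/mem_set.
exists (x - p); first exact: (closure_sub_preimage dc (@closed_ge _ e) eA).
move=> y Ay; set d := x - p.
(* Since [|d|^2 = <d, x> - <d, p>], the claim is that the angle at [p] between [x] and [y] is not
   acute. *)
suff : dotv d (y - p) <= 0.
  by rewrite sqr_enorm {3}/d !dotv_lin; lra.
set v := y - p; rewrite leNgt; apply/negP => w0; set w := dotv d v in w0.
set N := enorm v ^+ 2.
have N0 : 0 <= N by rewrite sqr_ge0.
(* Minimality of [p] against [p + t v] will give [2 w <= t N], while this [t] satisfies
   [t N <= t (w + N) = w]. The denominator [w + N] keeps [t <= 1]. *)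
pose t := w / (w + N).
have wN : 0 < w + N by lra.
have tE : t * (w + N) = w by rewrite mulfVK// gt_eqF.
have t0 : 0 < t by rewrite divr_gt0.
have t1 : t <= 1 by rewrite ler_pdivrMr//; lra.
have : closure A (t *: y + (1 - t) *: p).
  (* [p] is only in the closure, so convexity is used for [z] in [A] and passed to the limit in
     [z]. *)
  have fc : continuous (fun z : 'cV[R]_n => t *: y + (1 - t) *: z).
    by move=> z; exact: (cvgD (cvg_cst _) (@scaler_continuous _ _ (1 - t) z)).
  apply: (closure_sub_preimage fc (@closed_closure _ A) _ Ap) => z Az.
  by apply: subset_closure; apply: cA => //; rewrite t1 ltW.
move=> /pmin; rewrite (_ : x - (_ + _) = d - t *: v); last first.
  by apply/matrixP => i j; rewrite !mxE; ring.
rewrite -(@ler_pXn2r _ 2) ?nnegrE ?enorm_ge0//.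
rewrite (sqr_enormBZ d v) -/d -/w -/N => h.
have {}h : t * (w *+ 2) <= t * (t * N) by lra.
rewrite ler_pM2l// in h.
have : t * N <= w by rewrite -[leRHS]tE ler_pM2l//; lra.
by lra.
Qed.

(** * The domain of the support function and the polar of the recession cone *)

Section support.
Context {R : realType} {n : nat}.
Implicit Types C : set 'cV[R]_n.

Lemma support_domP C d : C !=set0 ->
  support_dom C d <-> exists M, forall x, C x -> dotv d x <= M.
Proof.
move=> [a Ca]; split=> [dC|[M dM]]; last first.
  rewrite /support_dom/= (le_lt_trans _ (ltry M))//.
  by apply: ge_ereal_sup => _ [x Cx <-]; rewrite lee_fin dM.
(* The point [a] excludes the value [-oo], so [fine] returns the true supremum. *)
have dfin : support_fun C d \is a fin_num.
  rewrite fin_real// dC andbT (lt_le_trans (ltNyr (dotv d a)))//.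
  by apply: ereal_sup_ubound; exists a.
exists (fine (support_fun C d)) => x Cx.
by rewrite -lee_fin fineK//; apply: ereal_sup_ubound; exists x.
Qed.

Lemma support_funR_lub C d : C !=set0 -> support_dom C d ->
  (forall x, C x -> dotv d x <= support_funR C d) /\
  (forall M, (forall x, C x -> dotv d x <= M) -> support_funR C d <= M).
Proof.
move=> [a Ca] dC.
have dfin : support_fun C d \is a fin_num.
  rewrite fin_real// dC andbT (lt_le_trans (ltNyr (dotv d a)))//.
  by apply: ereal_sup_ubound; exists a.
split=> [x Cx|M dM]; rewrite -lee_fin fineK//.
  by apply: ereal_sup_ubound; exists x.
by apply: ge_ereal_sup => _ [x Cx <-]; rewrite lee_fin dM.
Qed.

Lemma support_funR_adherent C d e : C !=set0 -> support_dom C d -> 0 < e ->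
  exists2 x, C x & support_funR C d - e < dotv d x.
Proof.
move=> C0 dC e0; apply: contrapT => nx.
have [_ /(_ (support_funR C d - e))] := support_funR_lub C0 dC.
apply/not_implyP; split; last by lra.
move=> x Cx; rewrite leNgt; apply/negP => ?; apply: nx; by exists x.
Qed.

Lemma support_dom_sub_polar C : C !=set0 ->
  support_dom C `<=` polar (recession_cone C).
Proof.
move=> C0 d /(support_domP _ C0)[M dM] k Kk; rewrite leNgt; apply/negP => dk0.
have [a Ca] := C0.
have dMa := dM _ Ca.
(* The multiple of [k] is chosen so that [<d, _>] takes the value [M + 1]. *)
have /dM : C (a + ((M - dotv d a + 1) / dotv d k) *: k).
  by apply: Kk => //; rewrite divr_ge0 ?(ltW dk0)//; lra.
by rewrite dotvDr dotvZr mulfVK ?gt_eqF//; lra.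
Qed.

(** A bipolar argument: a vector [f] separating [p] from the closed convex cone [support_dom C]
    turns out to be a recession direction of [C], and [<p, f> > 0] contradicts [p] being polar. *)
Lemma polar_sub_support_dom C : C !=set0 -> closed C ->
  @convex_set R 'cV[R]_n C -> closed (support_dom C) ->
  polar (recession_cone C) `<=` support_dom C.
Proof.
move=> C0 Ccl cC Dcl p pP; apply: contrapT => nDp.
have D0 : support_dom C 0.
  by apply/support_domP => //; exists 0 => x _; rewrite dotv0l.
have DZ t y : 0 <= t -> support_dom C y -> support_dom C (t *: y).
  move=> t0 /(support_domP _ C0)[M yM]; apply/support_domP => //.
  by exists (t * M) => x Cx; rewrite dotvZl ler_wpM2l ?yM.
have Dconv : @convex_set R 'cV[R]_n (support_dom C).
  apply/convex_setP => y z t /andP[t0 t1].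
  move=> /(support_domP _ C0)[M yM] /(support_domP _ C0)[N zN].
  apply/support_domP => //; exists (t * M + (1 - t) * N) => x Cx.
  by rewrite dotvDl !dotvZl lerD// ler_wpM2l ?yM ?zN//; lra.
have [e e0 pe] := closed_enorm_dist Dcl nDp.
have [f ef fD] := convex_separation (ex_intro _ 0 D0) Dconv pe.
have f0 : 0 < enorm f ^+ 2 by rewrite exprn_gt0// (lt_le_trans e0).
have fp : 0 < dotv f p.
  by have := fD _ D0; rewrite dotv0r add0r; exact: lt_le_trans.
(* Were [<f, y>] positive, a multiple of [y] in the cone would reach the value [<f, p>], closing the
   gap. *)
have fD0 y : support_dom C y -> dotv f y <= 0.
  move=> Dy; rewrite leNgt; apply/negP => fy0.
  have /fD : support_dom C ((dotv f p / dotv f y) *: y).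
    by apply: DZ => //; rewrite divr_ge0// ltW.
  by rewrite dotvZr mulfVK ?gt_eqF//; lra.
suff /pP : recession_cone C f by rewrite dotvC; lra.
(* If [x + mu f] left [C], a separating [g] would be bounded above on [C], hence in the domain. Then
   [<f, g> <= 0], so [<g, _>] could not increase from [x] to [x + mu f]. *)
move=> x mu Cx mu0; apply: contrapT => /(closed_enorm_dist Ccl)[r r0 rC].
have [g rg gC] := convex_separation C0 cC rC.
have g0 : 0 < enorm g ^+ 2 by rewrite exprn_gt0// (lt_le_trans r0).
have Dg : support_dom C g.
  apply/support_domP => //; exists (dotv g (x + mu *: f)) => y /gC; lra.
have /(mulr_ge0_le0 mu0) := fD0 _ Dg.
by have := gC _ Cx; rewrite dotvDr dotvZr (dotvC f); lra.
Qed.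

Lemma closed_polar C : closed (polar C).
Proof.
rewrite (_ : polar C = \bigcap_(x in C) [set y | dotv x y <= 0]).
  apply: closed_bigI => x _; apply: closed_le_preimage.
  exact: dotv_continuous.
by apply/seteqP; split=> [y yP x Cx|y yP x Cx] /=; rewrite dotvC; exact: yP.
Qed.

(** * From approximate decomposability to a closed domain and continuity *)

Lemma scale_unit_ballP (r : R) (x : 'cV[R]_n) : 0 < r ->
  scale_set r (@unit_ball R n) x <-> enorm x <= r.
Proof.
move=> r0; split=> [[b b1 <-]|xr].
  by rewrite enormZ gtr0_norm// -[leRHS]mulr1 ler_wpM2l// ltW.
exists (r^-1 *: x); last by rewrite scalerA mulfV ?scale1r ?gt_eqF.
rewrite /unit_ball/= enormZ gtr0_norm ?invr_gt0//.
by rewrite ler_pdivrMl// mulr1.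
Qed.

(** Write [x = y + k + b]: the recession part [k] contributes at most 0 because [d] is polar, and
    [b] at most [e |d|] by Cauchy-Schwarz. *)
Lemma approx_support_fun_le C r e : 0 < r -> 0 < e ->
  C `<=` minkowski_sum (truncation C r) (scale_set e (@unit_ball R n)) ->
  forall d x, polar (recession_cone C) d -> C x ->
  exists y, [/\ C y, enorm y <= r & dotv d x <= dotv d y + e * enorm d].
Proof.
move=> r0 e0 Cre d x Pd /Cre[_ [y [Cy yr] [k Kk <-]] [b be <-]].
move/(scale_unit_ballP _ r0) : yr => yr.
move/(scale_unit_ballP _ e0) : be => be.
exists y; split=> //; rewrite !dotvDr.
have := Pd _ Kk; have := CauchySchwarz_dotv d b.
have : enorm d * enorm b <= e * enorm d.
  by rewrite mulrC ler_wpM2r// enorm_ge0.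
lra.
Qed.

Lemma approx_M_decomposable_support C : C !=set0 -> approx_M_decomposable C ->
  closed (support_dom C) /\ {within support_dom C, continuous (support_funR C)}.
Proof.
move=> C0 aC.
have DP : support_dom C = polar (recession_cone C).
  apply/seteqP; split; first exact: support_dom_sub_polar.
  move=> d Pd; have [r r0 Cr] := aC 1 ltr01.
  apply/support_domP => //; exists (enorm d * r + 1 * enorm d) => x Cx.
  have [y [Cy yr dxy]] := approx_support_fun_le r0 ltr01 Cr Pd Cx.
  rewrite (le_trans dxy)// lerD2r (le_trans (CauchySchwarz_dotv _ _))//.
  by rewrite ler_wpM2l// enorm_ge0.
split; first by rewrite DP; exact: closed_polar.
apply/subspace_continuousP => d Dd; apply/cvgrPdist_lt => e e0.
have d1 : 0 < enorm d + 1 by rewrite ltr_wpDl ?enorm_ge0.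
(* This tolerance keeps [h |u| <= e / 2] for all [u] with [|u| <= |d| + 1], hence near [d]. *)
pose h := e / 2 / (enorm d + 1).
have h0 : 0 < h by rewrite !divr_gt0.
have [r r0 Cr] := aC _ h0.
(* A one-sided estimate, to be used with [d] and a nearby point in both orders: [y], almost as good
   as [x] for [u], is tested against [v] at a cost of at most [r |u - v|]. *)
have key u v : support_dom C u -> support_dom C v -> enorm u <= enorm d + 1 ->
    r * enorm (u - v) < e / 2 -> support_funR C u < support_funR C v + e.
  move=> Du Dv u1 ruv.
  suff : support_funR C u <= support_funR C v + r * enorm (u - v) + e / 2.
    by lra.
  have [_] := support_funR_lub C0 Du; apply => x Cx.
  have Pu : polar (recession_cone C) u by rewrite -DP.
  have [y [Cy yr]] := approx_support_fun_le r0 h0 Cr Pu Cx.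
  have [/(_ _ Cy) vy _] := support_funR_lub C0 Dv.
  have : h * enorm u <= e / 2.
    by rewrite /h mulrAC ler_pdivrMr// ler_wpM2l//; lra.
  have : enorm y * enorm (u - v) <= r * enorm (u - v).
    by rewrite ler_wpM2r// enorm_ge0.
  have := CauchySchwarz_dotv y (u - v).
  rewrite dotvDr dotvNr !(dotvC y); lra.
have near1 : \forall u \near d, enorm u < enorm d + 1.
  by apply: (cvgr_lt _ (@enorm_continuous _ _ d)); lra.
have near2 : \forall u \near d, enorm (d - u) < e / 2 / r.
  apply: (cvgr_lt _ (@enormB_continuous _ _ d d)).
  by rewrite subrr -(scale0r 0) enormZ normr0 mul0r !divr_gt0.
rewrite near_withinE; near=> u => Du.
have u1 : enorm u < enorm d + 1 by near: u.
have : enorm (d - u) < e / 2 / r by near: u.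
rewrite ltr_pdivlMr// mulrC => dur.
have dur' : r * enorm (u - d) < e / 2 by rewrite -enormN opprB.
have := key _ _ Dd Du (ler_wpDr ler01 (lexx _)) dur.
have := key _ _ Du Dd (ltW u1) dur'.
by move=> ? ?; rewrite /from_subspace ltr_norml; apply/andP; split; lra.
Unshelve. all: by end_near. Qed.

(** * Truncations, and from a closed domain and continuity to approximate decomposability *)

Lemma recession_cone0 C : recession_cone C 0.
Proof. by move=> x mu Cx _; rewrite scaler0 addr0. Qed.

Lemma recession_coneZ C t k : 0 <= t -> recession_cone C k ->
  recession_cone C (t *: k).
Proof.
by move=> t0 Kk x mu Cx mu0; rewrite scalerA; apply: Kk => //; exact: mulr_ge0.
Qed.

Lemma recession_coneD C k l : recession_cone C k -> recession_cone C l ->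
  recession_cone C (k + l).
Proof.
by move=> Kk Kl x mu Cx mu0; rewrite scalerDr addrA; apply: Kl => //; exact: Kk.
Qed.

Lemma convex_truncation C r : 0 < r -> @convex_set R 'cV[R]_n C ->
  @convex_set R 'cV[R]_n (truncation C r).
Proof.
move=> r0 /convex_setP cC; apply/convex_setP => u v t t01.
move=> [x [Cx /(scale_unit_ballP _ r0) xr] [k Kk <-]].
move=> [y [Cy /(scale_unit_ballP _ r0) yr] [l Kl <-]].
have /andP[t0 t1] := t01; have t1' : 0 <= 1 - t by lra.
exists (t *: x + (1 - t) *: y); [split; [exact: cC|]|].
  apply/scale_unit_ballP => //; rewrite (le_trans (enormD _ _))// !enormZ.
  have -> : r = t * r + (1 - t) * r by ring.
  by rewrite !ger0_norm// lerD// ler_wpM2l.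
exists (t *: k + (1 - t) *: l).
  by apply: recession_coneD; exact: recession_coneZ.
by rewrite !scalerDr addrACA.
Qed.

(* Dini's theorem for the support functions of the intersections of [C] with
   [r B]. *)
Lemma support_funR_uniform_approx C e : C !=set0 -> 0 < e ->
  closed (support_dom C) ->
  {within support_dom C, continuous (support_funR C)} ->
  \forall r \near +oo, forall d, support_dom C d -> enorm d = 1 ->
    exists x, [/\ C x, enorm x <= r & support_funR C d - e < dotv d x].
Proof.
move=> C0 e0 Dcl /subspace_continuousP sc.
pose S := support_dom C `&` [set d | enorm d = 1].
have Scpt : compact S.
  apply: (@enorm_bounded_closed_compact _ _ 1); last by move=> d [_ /= ->].
  apply: closedI => //.
  rewrite (_ : [set d | _] = [set d | 1 <= enorm d] `&` [set d | enorm d <= 1]).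
    apply: closedI; [apply: closed_ge_preimage|apply: closed_le_preimage];
      exact: enorm_continuous.
  apply/seteqP; split=> d /= => [->//|[d1 d1']].
  by apply/le_anti/andP.
pose P (r : R) d :=
  exists x, [/\ C x, enorm x <= r & support_funR C d - e < dotv d x].
suff : \forall r \near +oo, S `<=` P r.
  by apply: filterS => r SP d Dd d1; apply: SP; split.
(* Compactness in covering form: it is enough to treat [u] near one [d] and [r] large
   simultaneously. *)
move/compact_near_coveringP/near_covering_withinP : Scpt; apply.
move=> d [Dd d1].
have e3 : 0 < e / 3 by rewrite divr_gt0.
(* The same [x] serves all [u] near [d]. The three thirds of [e] pay for the choice of [x], for the
   growth of the support function from [d] to [u], and for the drop from [<d, x>] to [<u, x>]. *)
have [x Cx xd] := support_funR_adherent C0 Dd e3.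
have : \forall u \near within (support_dom C) (nbhs d),
    support_funR C u < support_funR C d + e / 3.
  by apply: (cvgr_lt _ (sc _ Dd)); rewrite ltrDl.
rewrite near_withinE => near1.
have near2 : \forall u \near d, dotv d x - e / 3 < dotv u x.
  have : dotv d x - e / 3 < dotv x d by rewrite dotvC; lra.
  move=> /(cvgr_gt _ (@dotv_continuous _ _ x d)).
  by apply: filterS => u; rewrite (dotvC x).
exists ([set u |
      (support_dom C u -> support_funR C u < support_funR C d + e / 3) /\
      dotv d x - e / 3 < dotv u x], [set r | enorm x <= r]).
  split=> /=; first by apply: filterI.
  by apply: nbhs_pinfty_ge; exact: num_real.
move=> [u r] /= [[u1 u2] xr] [Du _]; exists x; split=> //.
by have := u1 Du; lra.
Qed.

Lemma support_approx_M_decomposable C :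
  C !=set0 -> closed C -> @convex_set R 'cV[R]_n C ->
  closed (support_dom C) ->
  {within support_dom C, continuous (support_funR C)} ->
  approx_M_decomposable C.
Proof.
move=> C0 Ccl cC Dcl sc e e0.
have [a Ca] := C0.
(* The bound on [a] makes the truncation nonempty, as separation requires. *)
have : \forall r \near +oo, [/\ 0 < r, enorm a <= r & forall d,
    support_dom C d -> enorm d = 1 ->
    exists x, [/\ C x, enorm x <= r & support_funR C d - e < dotv d x]].
  near=> r; split; near: r.
  - by apply: nbhs_pinfty_gt; exact: num_real.
  - by apply: nbhs_pinfty_ge; exact: num_real.
  - exact: support_funR_uniform_approx.
move=> /filter_ex[r [r0 ar rP]]; exists r => // z Cz; apply: contrapT => nz.
have zC y : truncation C r y -> e <= enorm (z - y).
  move=> Cry; rewrite leNgt; apply/negP => /ltW zy; apply: nz.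
  exists y => //; exists (z - y); first exact/scale_unit_ballP.
  by rewrite addrC subrK.
have subC x k : C x -> enorm x <= r -> recession_cone C k ->
    truncation C r (x + k).
  move=> Cx xr Kk; exists x; last by exists k.
  by split=> //; exact/scale_unit_ballP.
have subC0 x : C x -> enorm x <= r -> truncation C r x.
  by move=> Cx xr; rewrite -[x]addr0; apply: subC => //; exact: recession_cone0.
have Cr0 : truncation C r !=set0 by exists a; exact: subC0.
have [d ed dC] := convex_separation Cr0 (convex_truncation r0 cC) zC.
have d0 : 0 < enorm d by exact: lt_le_trans ed.
have Dd : support_dom C d.
  (* The truncation contains [a] plus the recession cone. If [<d, k>] were positive, a multiple of
     [k] would bring [<d, _>] to [<d, z> + 1] on it, against the separation. *)
  apply: polar_sub_support_dom => // k Kk; rewrite leNgt; apply/negP => dk0.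
  have dd0 : 0 <= enorm d ^+ 2 by rewrite sqr_ge0.
  have daz := dC _ (subC0 _ Ca ar).
  have t0 : 0 <= (dotv d z - dotv d a + 1) / dotv d k.
    by rewrite divr_ge0 ?(ltW dk0)//; lra.
  have := dC _ (subC a _ Ca ar (recession_coneZ t0 Kk)).
  by rewrite dotvDr dotvZr mulfVK ?gt_eqF//; lra.
pose u := (enorm d)^-1 *: d.
have u1 : enorm u = 1.
  by rewrite enormZ gtr0_norm ?invr_gt0// mulVf// gt_eqF.
have Du : support_dom C u.
  move: Dd => /(support_domP _ C0)[M dM]; apply/support_domP => //.
  exists ((enorm d)^-1 * M) => x Cx.
  by rewrite dotvZl ler_wpM2l ?dM// invr_ge0 enorm_ge0.
have [x [Cx xr ux]] := rP _ Du u1.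
have [/(_ _ Cz) uz _] := support_funR_lub C0 Du.
have := dC _ (subC0 _ Cx xr).
have dE y : dotv d y = enorm d * dotv u y.
  by rewrite dotvZl mulrA mulfV ?mul1r// gt_eqF.
(* Dividing by [|d|] gives [<u, x> + |d| <= <u, z>], but [<u, z>] is at most the support function at
   [u], which is below [<u, x> + e]; this contradicts [e <= |d|]. *)
rewrite !dE expr2 -mulrDr ler_pM2l//; lra.
Unshelve. all: by end_near. Qed.

End support.

Unset Implicit Arguments.
Set Strict Implicit.

Theorem theorem3p10 (R : realType) (n : nat) (C : set 'cV[R]_n)
    (C_neq0 : C !=set0) (C_closed : closed C)
    (C_convex : @convex_set R 'cV[R]_n C) :
  (approx_M_decomposable C <->
     closed (support_dom C) /\
     {within support_dom C, continuous (support_funR C)}) /\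
  (closed (support_dom C) /\
     {within support_dom C, continuous (support_funR C)} ->
   support_dom C = polar (recession_cone C)).
Proof.
split; first split.
- exact: approx_M_decomposable_support.
- by move=> [Dcl sc]; exact: support_approx_M_decomposable.
- move=> [Dcl _]; apply/seteqP; split; first exact: support_dom_sub_polar.
  exact: polar_sub_support_dom.
Qed.
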